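(* Let $b>0$ and $y_{\mathrm{min}}<y_{\mathrm{max}}$ be real numbers. For all $r\in\mathcal{R}$ with $$\sqrt{b}\cdot\frac{y_{\mathrm{max}}-y_{\mathrm{min}}}{2}\le r\Bigl(\frac{y_{\mathrm{min}}+y_{\mathrm{max}}}{2}\Bigr)$$ the equality $$f_{\mathrm{c}}^{(r)}=f_{\mathrm{c}}^{(r_0)}$$ holds, where $f_{\mathrm{c}}^{(r)}$ and $f_{\mathrm{c}}^{(r_0)}$ are the convex envelopes of the condensed energies $f^{(r)}$ and $f^{(r_0)}$ on $\mathbb{R}^2$.
   Context: For fixed $b>0$ and $y_{\mathrm{min}}<y_{\mathrm{max}}$, the set of admissible dissipation functions is $$\mathcal{R}=\{r\in C(\mathbb{R},[0,\infty)): \operatorname{supp}(r)=[y_{\mathrm{min}},y_{\mathrm{max}}],\ r|_{[y_{\mathrm{min}},y_{\mathrm{max}}]}\text{ concave}\},$$ where $\operatorname{supp}$ denotes the (closed) support. Put $y_{\mathrm{mid}}=(y_{\mathrm{min}}+y_{\mathrm{max}})/2$ and define the piecewise affine function $r_0\in\mathcal{R}$ by $$r_0(y_1)=\sqrt{b}\left(\frac{y_{\mathrm{max}}-y_{\mathrm{min}}}{2}-|y_1-y_{\mathrm{mid}}|\right)\chi_{[y_{\mathrm{min}},y_{\mathrm{max}}]}(y_1),$$ with $\chi$ the characteristic (indicator) function. For $r\in\mathcal{R}$ the condensed energy is $$f^{(r)}(y)=\frac12(y_1^2+y_2^2)-\frac{(|y_2|-r(y_1))_+^2}{2(b+1)},\qquad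 y=(y_1,y_2)\in\mathbb{R}^2,$$ where $(x)_+=\max\{0,x\}$ and $(x)_+^2=((x)_+)^2$. The convex envelope $f_{\mathrm{c}}$ of a function $f:\mathbb{R}^2\to\mathbb{R}$ is the largest convex function on $\mathbb{R}^2$ that is $\le f$ pointwise. *)

(* Defs.v *)
From HB Require Import structures.
From mathcomp Require Import all_boot all_order all_algebra.
From mathcomp Require Import all_classical all_reals all_analysis.
From mathcomp Require Import ring lra.

Set Implicit Arguments.
Unset Strict Implicit.
Unset Printing Implicit Defensive.

Import Order.TTheory GRing.Theory Num.Theory.
Import numFieldNormedType.Exports.

Local Open Scope classical_set_scope.
Local Open Scope ring_scope.

(* [convex_function] requires a left module as domain, hence the plane is
   R^o * R^o, with points y = (y.1, y.2), rather than R * R. *)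

Definition concave_function (R : realType) (D : set R^o) (f : R -> R) : Prop :=
  convex_function D (fun x => - f x).

Definition closed_support (R : realType) (f : R -> R) : set R :=
  closure [set x : R | f x != 0].

Definition admissible (R : realType) (ymin ymax : R) : set (R -> R) :=
  [set r : R -> R | [/\ continuous r, forall x, 0 <= r x,
               closed_support r = `[ymin, ymax]%classic
             & concave_function `[ymin, ymax]%classic r]].

Definition midpoint (R : realType) (ymin ymax : R) : R := (ymin + ymax) / 2.

Definition r0 (R : realType) (b ymin ymax : R) : R -> R := fun y1 =>
  Num.sqrt b * ((ymax - ymin) / 2 - `|y1 - midpoint ymin ymax|)
    * \1_(`[ymin, ymax]%classic) y1.

Lemma r0E (R : realType) (b ymin ymax x : R) : ymin < ymax ->
  r0 b ymin ymax x =
  Num.sqrt b * Num.max 0 ((ymax - ymin) / 2 - `|x - midpoint ymin ymax|).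
Proof.
move=> hy; rewrite /r0 /midpoint indicE mem_setE in_itv/= -mulrA; congr (_ * _).
case: (boolP (ymin <= x <= ymax)) => /= [/andP[h1 h2]|].
  rewrite mulr1 max_r// subr_ge0 ler_norml; apply/andP; split; lra.
rewrite mulr0 negb_and -!ltNge => h; rewrite max_l// subr_le0.
by case/orP: h => h; [rewrite ltr0_norm ?gtr0_norm|rewrite gtr0_norm]; lra.
Qed.

Lemma r0_admissible (R : realType) (b ymin ymax : R) :
  0 < b -> ymin < ymax -> admissible ymin ymax (r0 b ymin ymax).
Proof.
move=> b0 hy; have sb : 0 < Num.sqrt b by rewrite sqrtr_gt0.
split.
- move=> x; rewrite (_ : r0 b ymin ymax = fun x =>
    Num.sqrt b * Num.max 0 ((ymax - ymin) / 2 - `|x - midpoint ymin ymax|));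
    last by apply/funext => z; exact: r0E.
  apply: cvgM; first exact: cvg_cst.
  apply: (@continuous_max R R (fun=> 0 : R^o)
    (fun z => (ymax - ymin) / 2 - `|z - midpoint ymin ymax| : R^o)).
    exact: cvg_cst.
  apply: cvgB; first exact: cvg_cst.
  by apply: cvg_norm; apply: cvgB; [exact: cvg_id|exact: cvg_cst].
- by move=> x; rewrite r0E // mulr_ge0 ?sqrtr_ge0// le_max lexx.
- rewrite /closed_support (_ : [set x : R | _] = `]ymin, ymax[%classic).
    apply/seteqP; split; first exact: itv_closure.
    move=> p /=; rewrite in_itv/= => /andP[p1 p2] B /nbhs_ballP[e /= e0 pB].
    pose s := Num.min 1 (e / (ymax - ymin)).
    have d0 : 0 < ymax - ymin by rewrite subr_gt0.
    have s0 : 0 < s by rewrite lt_min ltr01 divr_gt0.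
    have s1 : s <= 1 by rewrite ge_min lexx.
    have se : s * (ymax - ymin) <= e by rewrite -ler_pdivlMr// ge_min lexx orbT.
    exists (p + s * (midpoint ymin ymax - p)); split.
      by rewrite /= in_itv/= /midpoint; apply/andP; split; nra.
    apply: pB; rewrite /ball/= opprD addNKr normrN normrM gtr0_norm//.
    apply: lt_le_trans se; rewrite ltr_pM2l// /midpoint.
    by rewrite ltr_norml; apply/andP; split; lra.
  apply/seteqP; split => x /=; rewrite r0E // in_itv/= mulf_eq0 gt_eqF//= /midpoint.
    apply: contraNT; rewrite negb_and -!leNgt => h.
    rewrite max_l// subr_le0.
    by case/orP: h => h; [rewrite ler0_norm|rewrite ger0_norm]; lra.
  move=> /andP[h1 h2]; apply: lt0r_neq0; rewrite lt_max ltxx/= subr_gt0.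
  by rewrite ltr_norml; apply/andP; split; lra.
- move=> t x y; rewrite !inE/= !in_itv/= => /andP[x1 x2] /andP[y1 y2].
  have t1 : t%:num <= 1 by [].
  rewrite convRE (_ : conv t x y = t%:num * (x : R) + (1 - t%:num) * (y : R))//.
  have t0 : 0 <= t%:num by [].
  rewrite -[unstable.onem _]/(1 - t%:num); move: t0 t1 x1 x2 y1 y2.
  move: t%:num (x : R) (y : R) => {}t {}x {}y t0 t1 x1 x2 y1 y2.
  have r0I z : ymin <= z <= ymax -> r0 b ymin ymax z =
      Num.sqrt b * ((ymax - ymin) / 2 - `|z - midpoint ymin ymax|).
    by move=> zi; rewrite /r0 indicE mem_setE in_itv/= zi mulr1.
  rewrite !r0I ?x1 ?x2 ?y1 ?y2//; last first.
    move: t1; rewrite -subr_ge0 => t1; apply/andP; split.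
      have := mulr_ge0 t0 (_ : 0 <= x - ymin); rewrite subr_ge0 => /(_ x1).
      have := mulr_ge0 t1 (_ : 0 <= y - ymin); rewrite subr_ge0 => /(_ y1).
      by lra.
    have := mulr_ge0 t0 (_ : 0 <= ymax - x); rewrite subr_ge0 => /(_ x2).
    have := mulr_ge0 t1 (_ : 0 <= ymax - y); rewrite subr_ge0 => /(_ y2).
    by lra.
  set m := midpoint _ _; set L := _ / 2.
  have N : `|t * x + (1 - t) * y - m| <=
           t * `|x - m| + (1 - t) * `|y - m|.
    rewrite [in leLHS](_ : _ - m = t * (x - m) + (1 - t) * (y - m)).
      rewrite (le_trans (ler_normD _ _))// !normrM (ger0_norm t0) (@ger0_norm _ (1 - t)) ?subr_ge0//.
    by ring.
  have := ler_wpM2l (ltW sb) N => N'.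
  by move: N'; set A := `|_|; set B := `|_|; set C := `|_|; nra.
Qed.

Definition condensed_energy (R : realType) (b : R) (r : R -> R)
    (y : R^o * R^o) : R :=
  1 / 2 * (y.1 ^+ 2 + y.2 ^+ 2)
    - Num.max 0 (`|y.2| - r y.1) ^+ 2 / (2 * (b + 1)).

Definition convex_minorant (R : realType) (E : lmodType R) (f h : E -> R) :
    Prop :=
  convex_function [set: E] h /\ forall y, h y <= f y.

Definition is_convex_envelope (R : realType) (E : lmodType R) (f g : E -> R) :
    Prop :=
  convex_minorant f g /\
  forall h, convex_minorant f h -> forall y, h y <= g y.

(* [get P] is an arbitrary element of [P], and a default point if [P] is empty:
   the value is meaningful as soon as [f] has a convex minorant, see
   [convex_envelopeP] and [condensed_envelopeP]. *)
Definition convex_envelope (R : realType) (E : lmodType R) (f : E -> R) :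
    E -> R :=
  get (is_convex_envelope f).

Lemma is_convex_envelope_uniq (R : realType) (E : lmodType R)
    (f g1 g2 : E -> R) :
  is_convex_envelope f g1 -> is_convex_envelope f g2 -> g1 = g2.
Proof.
move=> [m1 l1] [m2 l2]; apply/funext => y; apply/le_anti.
by rewrite l1// l2.
Qed.

Lemma convex_envelopeP (R : realType) (E : lmodType R) (f h : E -> R) :
  convex_minorant f h -> is_convex_envelope f (convex_envelope f).
Proof.
move=> fh; apply: getPex.
pose S y := [set k y | k in convex_minorant f].
have S0 y : S y !=set0 by exists (h y), h.
have Sf y : ubound (S y) (f y) by move=> _ [k [_ kf] <-].
have Sk k y : convex_minorant f k -> k y <= sup (S y).
  by move=> fk; apply: ub_le_sup; [exists (f y) | exists k].
exists (fun y => sup (S y)); split; last by move=> k fk y; exact: Sk.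
split; last by move=> y; apply: ge_sup.
move=> t x y _ _; apply: ge_sup => // _ [k fk <-].
apply: (le_trans (fk.1 t x y _ _)); rewrite ?inE//.
by rewrite !convRE lerD// ler_wpM2l ?subr_ge0 ?Sk.
Qed.

Lemma condensed_energy_ge0 (R : realType) (b : R) (r : R -> R) :
  0 < b -> (forall x, 0 <= r x) -> forall y, 0 <= condensed_energy b r y.
Proof.
move=> b0 r_ge0 [y1 y2]; rewrite /condensed_energy/=.
have h : Num.max 0 (`|y2| - r y1) ^+ 2 <= y2 ^+ 2.
  rewrite -(real_normK (num_real y2)) lerXn2r ?nnegrE ?le_max ?lexx//.
  by rewrite ge_max normr_ge0/= lerBlDr lerDl r_ge0.
have : Num.max 0 (`|y2| - r y1) ^+ 2 / (2 * (b + 1)) <= y2 ^+ 2 / 2.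
  rewrite ler_pdivrMr; last lra.
  have := sqr_ge0 y2; nra.
have := sqr_ge0 y1; lra.
Qed.

Lemma condensed_envelopeP (R : realType) (b : R) (r : R -> R) :
  0 < b -> (forall x, 0 <= r x) ->
  is_convex_envelope (condensed_energy b r)
    (convex_envelope (condensed_energy b r)).
Proof.
move=> b0 r_ge0; apply: (@convex_envelopeP _ _ _ (fun=> 0)).
split; last exact: condensed_energy_ge0.
by move=> t x y _ _; rewrite convRE !mulr0 addr0.
Qed.

(* Main.v *)
Require Import Defs.
From HB Require Import structures.
From mathcomp Require Import all_boot all_order all_algebra.
From mathcomp Require Import all_classical all_reals all_analysis.
From mathcomp Require Import ring lra.

Import Order.TTheory GRing.Theory Num.Theory.
Import numFieldNormedType.Exports.

Local Open Scope classical_set_scope.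
Local Open Scope ring_scope.

(* Idea: concavity and r = 0 at the ends of [ymin, ymax] give r0 <= r, so one
   inequality between the envelopes is monotonicity.  For the other it is enough
   that every convex h below the energy of r is below the energy F0 of r0.  Let
   s = sqrt b, let L be the half-width of [ymin, ymax] and d the distance of y1
   to its boundary.  The energies agree with F0 for d = 0, and with |y|^2 / 2
   wherever |y2| <= s d.  In the remaining region, with v = |y2| >= s d, the
   Hessian of F0 in (d, v) is [1, s; s, b] / (b + 1), which is degenerate, and F0
   is affine along the lines d + s v = const.  Such a line starts at d = 0 and
   ends either on v = s d, where h <= F0 is known, or on the axis d = L at some
   v >= s L.  On the axis, h is bounded by its mean over the two boundary points
   of the same height, which suffices when v >= s L + L / s; below that height
   one interpolates between (L, s L) and (L, s L + L / s). *)

Lemma convex_function_plane (R : realType) (h : R^o * R^o -> R)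
    (t x1 x2 y1 y2 : R) :
  convex_function [set: R^o * R^o] h -> 0 <= t <= 1 ->
  h (t * x1 + (1 - t) * y1, t * x2 + (1 - t) * y2)
    <= t * h (x1, x2) + (1 - t) * h (y1, y2).
Proof.
move=> hc /andP[t0 t1].
have := hc (Itv01 t0 t1) (x1, x2) (y1, y2); rewrite !inE.
exact.
Qed.

Lemma concave_function_itv (R : realType) (a c : R) (r : R -> R) (t x y : R) :
  concave_function `[a, c]%classic r -> 0 <= t <= 1 ->
  x \in `[a, c] -> y \in `[a, c] ->
  t * r x + (1 - t) * r y <= r (t * x + (1 - t) * y).
Proof.
move=> rc /andP[t0 t1] xI yI.
have := rc (Itv01 t0 t1) x y; rewrite !inE => /(_ xI yI).
by rewrite convRE/= !mulrN -opprD lerN2.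
Qed.

(** By continuity the set where [r] is nonzero is open, so it lies in the interior of the support;
    this is what settles the end points. *)
Lemma admissible_eq0 (R : realType) (ymin ymax : R) (r : R -> R) (x : R) :
  admissible ymin ymax r -> x \notin `]ymin, ymax[ -> r x = 0.
Proof.
move=> [rcont _ supp _] xN; apply/eqP; apply: contraNT xN => rx.
have ro : open [set x : R | r x != 0].
  apply: (@open_comp _ _ r [set y | y != 0]) => [z _|]; first exact: rcont.
  exact: open_neq.
have : [set x : R | r x != 0] `<=` `[ymin, ymax]%classic.
  by rewrite -supp; exact: subset_closure.
by rewrite open_subsetE// interior_itv => /(_ x rx).
Qed.

Lemma r0_le (R : realType) (b ymin ymax : R) (r : R -> R) :
  ymin < ymax -> admissible ymin ymax r ->
  Num.sqrt b * ((ymax - ymin) / 2) <= r (midpoint ymin ymax) ->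
  forall x, r0 b ymin ymax x <= r x.
Proof.
move=> hy [_ r_ge0 _ rc] hmid x; rewrite r0E//.
set m := midpoint ymin ymax in hmid *; set L := (ymax - ymin) / 2 in hmid *.
have [dx|dx] := leP (L - `|x - m|) 0; first by rewrite mulr0.
have L0 : 0 < L by rewrite /L; lra.
(* [e] is the end point on the side of [x]. On the segment from [e] to [m], [r0] is affine with
   value 0 at [e], and [t] is the weight of [m]. *)
pose e := m + (-1) ^+ (x - m < 0)%R * L; pose t := (L - `|x - m|) / L.
have eI : e \in `[ymin, ymax].
  by rewrite /e in_itv/= /m /midpoint /L; case: (_ < 0); rewrite ?expr1 ?expr0; lra.
have t01 : 0 <= t <= 1.
  by rewrite divr_ge0 ?(ltW dx) ?(ltW L0)//= ler_pdivrMr// mul1r gerBl normr_ge0.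
have tL : t * L = L - `|x - m| by rewrite /t divfK// gt_eqF.
have xE : x = t * m + (1 - t) * e.
  rewrite /e mulrDr -[LHS](subrK m) {1}[x - m]numEsign.
  have -> : `|x - m| = (1 - t) * L by rewrite mulrBl tL; ring.
  ring.
rewrite [X in _ <= r X]xE.
apply: (le_trans _ (concave_function_itv _ _ _ _ t m e rc t01 _ eI)); last first.
  by rewrite in_itv/= /m /midpoint; lra.
rewrite -tL mulrCA -[leLHS]addr0 lerD//; first by rewrite ler_wpM2l//; lra.
by rewrite mulr_ge0 ?r_ge0//; lra.
Qed.

Lemma condensed_energy_homo (R : realType) (b : R) (r1 r2 : R -> R) :
  0 < b -> (forall x, r1 x <= r2 x) ->
  forall y, condensed_energy b r1 y <= condensed_energy b r2 y.
Proof.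
move=> b0 r12 y; rewrite /condensed_energy lerD2l lerN2 ler_pM2r; last first.
  by rewrite invr_gt0; lra.
by rewrite lerXn2r ?nnegrE ?ge_max ?le_max ?lexx//= lerD2l lerN2 r12 orbT.
Qed.

Lemma sqr_eq1_norm (R : realDomainType) (x : R) : x ^+ 2 = 1 -> `|x| = 1.
Proof. by move=> x2; apply/eqP; rewrite -sqrp_eq1// -normrX x2 normr1. Qed.
Arguments sqr_eq1_norm {R x}.

(** Coordinates: [sg] selects an end point [m + sg * L], [d] is the distance to it, [ep] the sign of
    the second coordinate. Since [r] enters only through the bounds at d = 0 and on |v| <= s d, it
    does not appear. *)
Lemma convex_le_tent (R : realType) (h : R^o * R^o -> R) (m L s b : R) :
  0 < L -> 0 < s -> s ^+ 2 = b ->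
  convex_function [set: R^o * R^o] h ->
  (forall sg z, sg ^+ 2 = 1 -> h (m + sg * L, z) <=
     ((m + sg * L) ^+ 2 + z ^+ 2) / 2 - z ^+ 2 / (2 * (b + 1))) ->
  (forall sg d v, sg ^+ 2 = 1 -> 0 <= d <= L -> `|v| <= s * d ->
     h (m + sg * (L - d), v) <= ((m + sg * (L - d)) ^+ 2 + v ^+ 2) / 2) ->
  forall sg ep d v, sg ^+ 2 = 1 -> ep ^+ 2 = 1 -> 0 <= d <= L -> s * d <= v ->
    h (m + sg * (L - d), ep * v) <=
    ((m + sg * (L - d)) ^+ 2 + v ^+ 2) / 2 - (v - s * d) ^+ 2 / (2 * (b + 1)).
Proof.
move=> L0 s0 sb hc hend hin.
have s2 : 0 < s ^+ 2 + 1 by rewrite ltr_wpDl ?sqr_ge0.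
have sN0 : s != 0 by rewrite gt_eqF.
have LN0 : L != 0 by rewrite gt_eqF.
have s2N0 : s ^+ 2 + 1 != 0 by rewrite gt_eqF.
have epX (ep v : R) : ep ^+ 2 = 1 -> (ep * v) ^+ 2 = v ^+ 2.
  by rewrite exprMn => ->; rewrite mul1r.
have avg ep v : ep ^+ 2 = 1 ->
    h (m, ep * v) <= (L ^+ 2 + m ^+ 2 + v ^+ 2) / 2 - v ^+ 2 / (2 * (b + 1)).
  move=> ep2; have half : 0 <= (1 / 2 : R) <= 1 by lra.
  have := convex_function_plane _ h (1 / 2) (m + 1 * L) (ep * v)
    (m + (-1) * L) (ep * v) hc half.
  rewrite (_ : 1 / 2 * (m + 1 * L) + _ = m); last by field.
  rewrite (_ : 1 / 2 * (ep * v) + _ = ep * v); last by field.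
  move=> /le_trans; apply.
  have := hend 1 (ep * v) (expr1n _ _).
  have := hend (-1) (ep * v); rewrite sqrrN expr1n epX// => /(_ erefl).
  by move: (h _) (h _) (_ / (2 * _)) => A B C; lra.
have mid ep v : ep ^+ 2 = 1 -> s * L <= v ->
    h (m, ep * v) <= (m ^+ 2 + v ^+ 2) / 2 - (v - s * L) ^+ 2 / (2 * (b + 1)).
  move=> ep2 hv; have [hv'|hv'] := leP (s * L + L / s) v.
    apply: le_trans (avg ep v ep2) _.
    have {}hv' : (s ^+ 2 + 1) * L <= s * v.
      have := ler_wpM2l (ltW s0) hv'; rewrite (_ : s * (_ + _) = (s ^+ 2 + 1) * L)//.
      by field.
    (* The factor in parentheses is nonnegative from v = s L + L / (2 s) on; the larger threshold
       suits the interpolation below. *)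
    rewrite -subr_ge0 -sb (_ : _ - _ = L * (2 * (s * v) - (s ^+ 2 + 1) * L - s ^+ 2 * L)
        / (2 * (s ^+ 2 + 1))); last by field.
    by rewrite divr_ge0 ?mulr_ge0 ?(ltW s2) ?(ltW L0)//; nra.
  (* The chord of F0 on the axis overshoots by t (1 - t) L^2 / (2 (b + 1)), but at [z] the averaged
     bound is L^2 / (2 (b + 1)) below F0. With weight [t] this pays for it and leaves (t L)^2 / (2
     (b + 1)). *)
  pose z := s * L + L / s; pose t := s * (v - s * L) / L.
  have vE : v = s * L + t * (L / s) by rewrite /t; field; rewrite sN0 LN0.
  have t01 : 0 <= t <= 1.
    rewrite divr_ge0 ?mulr_ge0 ?subr_ge0 ?(ltW s0) ?(ltW L0)//=.
    rewrite ler_pdivrMr// mul1r mulrC -ler_pdivlMr//; lra.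
  have := convex_function_plane _ h t m (ep * z) m (ep * (s * L)) hc t01.
  rewrite (_ : t * m + _ = m); last by ring.
  rewrite (_ : t * (ep * z) + _ = ep * v); last by rewrite vE /z; ring.
  move=> /le_trans; apply.
  have := avg ep z ep2.
  have := hin 1 L (ep * (s * L)) (expr1n _ _).
  rewrite subrr mulr0 addr0 epX// normrM (sqr_eq1_norm ep2) mul1r.
  rewrite ger0_norm ?mulr_ge0 ?(ltW L0) ?(ltW s0)// !lexx => /(_ erefl erefl).
  move: (h _) (h _) => A B hA hB.
  have /andP[t0 t1] := t01; rewrite -subr_ge0 in t1.
  apply: (le_trans (lerD (ler_wpM2l t0 hB) (ler_wpM2l t1 hA))).
  rewrite -subr_ge0 -sb vE (_ : _ - _ = (t * L) ^+ 2 / (2 * (s ^+ 2 + 1))).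
    by rewrite divr_ge0 ?sqr_ge0 ?mulr_ge0 ?(ltW s2).
  by rewrite /z; field; rewrite sN0 s2N0.
move=> sg ep d v sg2 ep2 /andP[d0 dL] hv.
(* [z] is the height at which the line d + s v = const through the point meets d = 0; [d'] below is
   the other end of the segment. *)
pose z := v + d / s; have vE : v = z - d / s by rewrite /z addrK.
suff [d' [dd' d'L hA]] : exists d', [/\ d <= d', d' <= L &
    h (m + sg * (L - d'), ep * (z - d' / s)) <=
    ((m + sg * (L - d')) ^+ 2 + (z - d' / s) ^+ 2) / 2 -
      (z - d' / s - s * d') ^+ 2 / (2 * (b + 1))].
  (* If d' = 0 the segment is a single point and the weight d / d' makes no sense. *)
  have [d'0|d'0] := leP d' 0.
    have d'E : d' = 0 by apply/le_anti; rewrite d'0 (le_trans d0 dd').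
    have dE : d = 0 by apply/le_anti; rewrite d0 (le_trans dd' d'0).
    by move: hA; rewrite d'E /z dE mul0r addr0 !subr0.
  have d'N0 : d' != 0 by rewrite gt_eqF.
  pose t := d / d'.
  have t01 : 0 <= t <= 1 by rewrite divr_ge0 ?(ltW d'0)//= ler_pdivrMr// mul1r.
  have dE : d = t * d' by rewrite /t divfK.
  have := convex_function_plane _ h t (m + sg * (L - d')) (ep * (z - d' / s))
    (m + sg * L) (ep * z) hc t01.
  rewrite (_ : t * (m + _) + _ = m + sg * (L - d)); last by rewrite dE; ring.
  rewrite (_ : t * (ep * _) + _ = ep * v); last by rewrite vE dE; ring.
  move=> /le_trans; apply.
  have hB := hend sg (ep * z) sg2; rewrite epX// in hB.
  have /andP[t0 t1] := t01; rewrite -subr_ge0 in t1.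
  apply: (le_trans (lerD (ler_wpM2l t0 hA) (ler_wpM2l t1 hB))).
  (* Equality holds, F0 being affine along the segment. *)
  rewrite le_eqVlt; apply/orP; left; apply/eqP.
  have sqE x : (m + sg * x) ^+ 2 = m ^+ 2 + 2 * m * sg * x + x ^+ 2.
    by rewrite sqrrD exprMn sg2; ring.
  by rewrite -sb vE dE !sqE; field; rewrite sN0 s2N0.
(* The line meets v = s d at d = s z / (s^2 + 1), which is at most [L] exactly when z <= s L + L /
   s; otherwise it reaches the axis above s L. *)
have [zL|zL] := leP z (s * L + L / s); last first.
  exists L; split=> //; rewrite subrr mulr0 addr0; apply: mid => //; lra.
have s2z : s * (s * L + L / s) = (s ^+ 2 + 1) * L by field.
have s2v : s * z = s * v + d by rewrite /z; field.
pose d' := s * z / (s ^+ 2 + 1); exists d'.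
have zE : z - d' / s = s * d' by rewrite /d'; field; rewrite sN0 s2N0.
have dd' : d <= d' by rewrite ler_pdivlMr// s2v; nra.
have d'L : d' <= L by rewrite ler_pdivrMr// [L * _]mulrC -s2z ler_wpM2l// ltW.
split=> //; rewrite zE subrr expr0n/= mul0r subr0 -(epX ep (s * d'))//.
apply: hin => //.
  by rewrite (le_trans d0 dd').
by rewrite normrM (sqr_eq1_norm ep2) mul1r ger0_norm// mulr_ge0 ?(ltW s0) ?(le_trans d0 dd').
Qed.

(** Off the open interval [r] and [r0] both vanish. Inside, [convex_le_tent] applies: its boundary
    bound comes from r = 0 at the ends, its inner bound from r0 <= r. *)
Lemma convex_minorant_r0 (R : realType) (b ymin ymax : R) (r : R -> R)
    (h : R^o * R^o -> R) :
  0 < b -> ymin < ymax -> admissible ymin ymax r ->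
  Num.sqrt b * ((ymax - ymin) / 2) <= r (midpoint ymin ymax) ->
  convex_minorant (condensed_energy b r) h ->
  convex_minorant (condensed_energy b (r0 b ymin ymax)) h.
Proof.
move=> b0 hy hr hmid [hc hle]; split=> // -[y1 y2].
have le_r0r := r0_le _ _ _ _ _ hy hr hmid.
have [y1I|y1N] := boolP (y1 \in `]ymin, ymax[); last first.
  have := hle (y1, y2); rewrite /condensed_energy/= (admissible_eq0 _ _ _ _ _ hr)//.
  by rewrite (admissible_eq0 _ _ _ _ _ (r0_admissible b0 hy)).
move: y1I; rewrite in_itv/= => /andP[y1l y1r].
set m := midpoint ymin ymax in hmid; set L := (ymax - ymin) / 2 in hmid.
set s := Num.sqrt b in hmid.
have s0 : 0 < s by rewrite sqrtr_gt0.
have sb : s ^+ 2 = b by rewrite sqr_sqrtr// ltW.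
have L0 : 0 < L by rewrite /L; lra.
have sgP (sg : R) : sg ^+ 2 = 1 -> sg = 1 \/ sg = -1.
  by move=> /eqP; rewrite sqrf_eq1 => /orP[]/eqP; [left|right].
have r0m sg d : sg ^+ 2 = 1 -> 0 <= d <= L ->
    r0 b ymin ymax (m + sg * (L - d)) = s * d.
  move=> sg2 /andP[d0 dL]; rewrite r0E// -/m -/L [m + _]addrC addrK.
  rewrite normrM (sqr_eq1_norm sg2) mul1r.
  by rewrite ger0_norm ?subr_ge0// subKr max_r.
have hend sg z : sg ^+ 2 = 1 -> h (m + sg * L, z) <=
    ((m + sg * L) ^+ 2 + z ^+ 2) / 2 - z ^+ 2 / (2 * (b + 1)).
  move=> sg2; have := hle (m + sg * L, z); rewrite /condensed_energy/=.
  rewrite (admissible_eq0 _ _ _ _ _ hr); last first.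
    by rewrite in_itv/= /m /L /midpoint; case: (sgP sg sg2) => ->; lra.
  by rewrite subr0 max_r// real_normK ?num_real// mul1r [2^-1 * _]mulrC.
have hin sg d v : sg ^+ 2 = 1 -> 0 <= d <= L -> `|v| <= s * d ->
    h (m + sg * (L - d), v) <= ((m + sg * (L - d)) ^+ 2 + v ^+ 2) / 2.
  move=> sg2 dI vd; have := hle (m + sg * (L - d), v); rewrite /condensed_energy/=.
  rewrite max_l; first by rewrite expr0n/= mul0r subr0 mul1r [2^-1 * _]mulrC.
  by rewrite subr_le0 (le_trans vd)// -(r0m sg).
(* Signs as powers of -1 have square 1 even when the argument is 0. *)
pose sg : R := (-1) ^+ (y1 - m < 0)%R; pose ep : R := (-1) ^+ (y2 < 0)%R.
pose d := L - `|y1 - m|.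
have dI : 0 <= d <= L.
  rewrite /d gerBl normr_ge0 andbT subr_ge0 ler_norml /L /m /midpoint.
  by apply/andP; split; lra.
have sg2 : sg ^+ 2 = 1 by rewrite sqrr_sign.
have ep2 : ep ^+ 2 = 1 by rewrite sqrr_sign.
have y1E : y1 = m + sg * (L - d) by rewrite subKr -numEsign addrC subrK.
have y2E : y2 = ep * `|y2| by exact: numEsign.
rewrite /condensed_energy/= [in r0 _ _ _ _]y1E r0m//.
have [vd|vd] := leP `|y2| (s * d).
  rewrite max_l ?subr_le0// expr0n/= mul0r subr0 mul1r [2^-1 * _]mulrC y1E.
  exact: hin.
rewrite max_r ?subr_ge0 ?(ltW vd)//.
have := convex_le_tent _ h m L s b L0 s0 sb hc hend hin sg ep d `|y2| sg2 ep2 dI (ltW vd).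
by rewrite -y1E -y2E real_normK ?num_real// mul1r [2^-1 * _]mulrC.
Qed.

Theorem corollary1 (R : realType) (b ymin ymax : R)
    (hb : 0 < b) (hy : ymin < ymax)
    (r : R -> R) (hr : admissible ymin ymax r)
    (hmid : Num.sqrt b * ((ymax - ymin) / 2) <= r (midpoint ymin ymax)) :
  convex_envelope (condensed_energy b r)
  = convex_envelope (condensed_energy b (r0 b ymin ymax)).
Proof.
have r_ge0 : forall x, 0 <= r x by case: hr.
have hr0 := r0_admissible hb hy.
have r0_ge0 : forall x, 0 <= r0 b ymin ymax x by case: hr0.
have le_r0r := r0_le _ _ _ _ _ hy hr hmid.
have env := condensed_envelopeP hb r_ge0.
have env0 := condensed_envelopeP hb r0_ge0.
(* The envelope for [r0] is shown to be one for [r]: maximality by [convex_minorant_r0], the upper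
   bound by monotonicity of the energy. *)
apply: (is_convex_envelope_uniq env); split; last first.
  by move=> h hm y; apply: env0.2; exact: convex_minorant_r0 hm.
split; first exact: env0.1.1.
by move=> y; apply: le_trans (condensed_energy_homo _ _ _ _ hb le_r0r y); exact: env0.1.2.
Qed.
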